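(* Let $\mathcal{L}\in\mathrm{DL_{nr}}$ admit nominals. Then one can construct, for any $\mathcal{L}$-ontology $O$, labelled data sets $P,N$, and signature $\Sigma$ with $\Sigma\cap\{a\mid(\mathcal{D},a)\in P\cup N\}=\emptyset$, in polynomial time $\mathcal{L}$-ontologies $O_1,O_2$ and $\mathcal{L}$-concepts $C_1,C_2$ such that $\Sigma=\mathrm{sig}(O_1,C_1)\cap\mathrm{sig}(O_2,C_2)$ and the following conditions are equivalent for all $\mathcal{L}$-concepts $C$: (1) $C$ is an $\mathcal{L}(\Sigma)$-separator for $O,P,N$; (2) $C$ is an $\mathcal{L}(\Sigma)$-interpolant for $C_1\sqsubseteq C_2$ under $O_1\cup O_2$. Conversely, given $\mathcal{L}$-ontologies $O_1,O_2$ and $\mathcal{L}$-concepts $C_1,C_2$, one can construct in polynomial time an $\mathcal{L}$-ontology $O$ and labelled data sets $P,N$ such that conditions (1) and (2) are equivalent for all $\mathcal{L}$-concepts $C$, for $\Sigma=\mathrm{sig}(O_1,C_1)\cap\mathrm{sig}(O_2,C_2)$.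
   Context: Description logics. Let $N_C,N_R,N_I$ be mutually disjoint countably infinite sets of concept, role and individual names. A role is a role name $s$ or an inverse role $s^-$ (with $(s^-)^-=s$); $u$ denotes the universal role. Concepts are given by $C,D::=\top\mid A\mid\{a\}\mid\neg C\mid C\sqcap D\mid\exists r.C$ with $A\in N_C$, $a\in N_I$, $r$ a role or $u$; $\sqcup,\to$ and $\forall r.C=\neg\exists r.\neg C$ are abbreviations. In the name of a DL extending $\mathcal{ALC}$, the letter $\mathcal{O}$ means nominals $\{a\}$ are admitted, $\mathcal{I}$ means inverse roles are admitted, the superscript $u$ means the universal role is admitted ($\mathcal{ALC}$ itself admits none of these); the letter $\mathcal{H}$ means that role inclusions (RIs) $r\sqsubseteq s$ between roles are admitted in ontologies (with inverse roles only if the DL admits them); $\mathcal{H}$ does not affect the concept language. An $\mathcal{L}$-ontology is a finite set of concept inclusions $C\sqsubseteq D$ ($C,D$ $\mathcal{L}$-concepts) and, if $\mathcal{L}$ admits RIs, RIs. $\mathrm{DL_{nr}}$ is the set consisting of $\mathcal{ALCO},\mathcal{ALCOI},\mathcal{ALCH},\mathcal{ALCHI},\mathcal{ALCHO},\mathcal{ALCHOI}$ and their extensions with the universal role. Semantics: an interpretation $I$ has a non-empty domain $\Delta^I$, with $A^I\subseteq\Delta^I$, $s^I\subseteq\Delta^I\times\Delta^I$, $a^I\in\Delta^I$, $u^I=\Delta^I\times\Delta^I$, $(s^-)^I$ the converse of $s^I$; $\{a\}^I=\{a^I\}$, Booleans as usual, $(\exists r.C)^I=\{d\mid\exists e\in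 C^I:(d,e)\in r^I\}$. $I$ satisfies $C\sqsubseteq D$ if $C^I\subseteq D^I$ and $r\sqsubseteq s$ if $r^I\subseteq s^I$; $I$ is a model of an ontology $O$ if it satisfies all its inclusions; $O\models\alpha$ if every model of $O$ satisfies $\alpha$. A signature is a (finite) set of concept, role and individual names ($u$ is not a symbol). $\mathrm{sig}(X)$ is the set of symbols in $X$; $\mathrm{sig}(O,C)=\mathrm{sig}(O)\cup\mathrm{sig}(C)$. An $\mathcal{L}(\Sigma)$-concept is an $\mathcal{L}$-concept $C$ with $\mathrm{sig}(C)\subseteq\Sigma$. An $\mathcal{L}(\Sigma)$-interpolant for $C_1\sqsubseteq C_2$ under $O$ is an $\mathcal{L}(\Sigma)$-concept $D$ with $O\models C_1\sqsubseteq D$ and $O\models D\sqsubseteq C_2$. A database $\mathcal{D}$ is a finite set of assertions $A(a)$ and $r(a,b)$ with $a,b\in N_I$, $A\in N_C$, $r\in N_R$; $\mathrm{ind}(\mathcal{D})$ is the set of individual names in it. A knowledge base is a pair $(O,\mathcal{D})$; $I$ is a model of it if $I$ is a model of $O$, $a^I\in A^I$ for all $A(a)\in\mathcal{D}$ and $(a^I,b^I)\in r^I$ for all $r(a,b)\in\mathcal{D}$; $(O,\mathcal{D})\models C(a)$ if $a^I\in C^I$ for every model $I$ of $(O,\mathcal{D})$. A labelled data set consists of two finite sets $P$ (positive examples) and $N$ (negative examples) of pairs $(\mathcal{D},a)$ with $\mathcal{D}$ a database and $a\in\mathrm{ind}(\mathcal{D})$. An $\mathcal{L}(\Sigma)$-separator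 for $O,P,N$ is an $\mathcal{L}(\Sigma)$-concept $C$ with $(O,\mathcal{D})\models C(a)$ for all $(\mathcal{D},a)\in P$ and $(O,\mathcal{D})\models\neg C(a)$ for all $(\mathcal{D},a)\in N$. *)

(* Defs.v *)
From HB Require Import structures.
From mathcomp Require Import all_boot.

Set Implicit Arguments.
Unset Strict Implicit.
Unset Printing Implicit Defensive.

(* Names are binary strings, so that each has a definite length when it occurs
   in the input of an algorithm. The three kinds of names are kept apart by
   their position in the syntax and, in signatures, by the constructors of
   [symbol]. *)
Notation name := (seq bool) (only parsing).

Inductive role := RName of name | RInv of name.

(* [Ex] is quantification over a role, [ExU] over the universal role u. *)
Inductive concept :=
  | Top
  | CName of name
  | Nominal of name
  | Neg of concept
  | And of concept & concept
  | Ex of role & concept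
  | ExU of concept.

Inductive inclusion := CI of concept & concept | RI of role & role.

(* Finite sets are represented by lists; only membership in them matters. *)
Definition ontology := seq inclusion.

(* The extension of ALC by the indicated letters (O, I, H, superscript u). *)
Record dl := DL {
  nominals : bool;
  inverses : bool;
  role_inclusions : bool;
  universal : bool }.

Definition DLnr (L : dl) : bool :=
  (nominals L, inverses L, role_inclusions L) \in
    [:: (true,  false, false)   (* ALCO   *)
      ; (true,  true,  false)   (* ALCOI  *)
      ; (false, false, true)    (* ALCH   *)
      ; (false, true,  true)    (* ALCHI  *)
      ; (true,  false, true)    (* ALCHO  *)
      ; (true,  true,  true)].  (* ALCHOI *)

Section Fragment.
Variable L : dl.

Definition role_in (r : role) : bool :=
  if r is RInv _ then inverses L else true.

Fixpoint concept_in (C : concept) : bool :=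
  match C with
  | Top | CName _ => true
  | Nominal _ => nominals L
  | Neg C => concept_in C
  | And C D => concept_in C && concept_in D
  | Ex r C => role_in r && concept_in C
  | ExU C => universal L && concept_in C
  end.

Definition inclusion_in (i : inclusion) : bool :=
  match i with
  | CI C D => concept_in C && concept_in D
  | RI r s => [&& role_inclusions L, role_in r & role_in s]
  end.

Definition ontology_in (O : ontology) : bool := all inclusion_in O.

End Fragment.

(* The domain is non-empty because it contains the values of [I_ind]. *)
Record interp := Interp {
  dom : Type;
  I_concept : name -> dom -> Prop;
  I_role : name -> dom -> dom -> Prop;
  I_ind : name -> dom }.

Definition role_sem (I : interp) (r : role) (d e : dom I) : Prop :=
  match r with
  | RName s => I_role s d e
  | RInv s => I_role s e d
  end.

Fixpoint sem (I : interp) (C : concept) (d : dom I) : Prop :=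
  match C with
  | Top => True
  | CName A => I_concept A d
  | Nominal a => d = I_ind I a
  | Neg C => ~ sem C d
  | And C D => sem C d /\ sem D d
  | Ex r C => exists2 e, role_sem r d e & sem C e
  | ExU C => exists e : dom I, sem C e
  end.

Definition satisfies (I : interp) (i : inclusion) : Prop :=
  match i with
  | CI C D => forall d : dom I, sem C d -> sem D d
  | RI r s => forall d e : dom I, role_sem r d e -> role_sem s d e
  end.

Definition model (I : interp) (O : ontology) : Prop :=
  foldr (fun i P => satisfies I i /\ P) True O.

Definition entails (O : ontology) (i : inclusion) : Prop :=
  forall I : interp, model I O -> satisfies I i.

Inductive symbol := SConcept of name | SRole of name | SInd of name.

Definition symbol_code (s : symbol) : name + name + name :=
  match s with
  | SConcept A => inl (inl A) | SRole r => inl (inr r) | SInd a => inr a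
  end.
Definition symbol_decode (s : name + name + name) : symbol :=
  match s with
  | inl (inl A) => SConcept A | inl (inr r) => SRole r | inr a => SInd a
  end.
Lemma symbol_codeK : cancel symbol_code symbol_decode.
Proof. by case. Qed.
HB.instance Definition _ := Equality.copy symbol (can_type symbol_codeK).

Definition signature := seq symbol.

Definition sig_role (r : role) : signature :=
  match r with RName s | RInv s => [:: SRole s] end.

Fixpoint sig_concept (C : concept) : signature :=
  match C with
  | Top => [::]
  | CName A => [:: SConcept A]
  | Nominal a => [:: SInd a]
  | Neg C => sig_concept C
  | And C D => sig_concept C ++ sig_concept D
  | Ex r C => sig_role r ++ sig_concept C
  | ExU C => sig_concept C
  end.

Definition sig_inclusion (i : inclusion) : signature :=
  match i with
  | CI C D => sig_concept C ++ sig_concept D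
  | RI r s => sig_role r ++ sig_role s
  end.

Definition sig_of (O : ontology) (C : concept) : signature :=
  flatten (map sig_inclusion O) ++ sig_concept C.

Definition common_sig (O1 : ontology) (C1 : concept)
    (O2 : ontology) (C2 : concept) : signature :=
  [seq s <- sig_of O1 C1 | s \in sig_of O2 C2].

Definition concept_over (L : dl) (S : signature) (C : concept) : Prop :=
  concept_in L C /\ {subset sig_concept C <= S}.

Definition interpolant (L : dl) (S : signature) (O : ontology)
    (C1 C2 D : concept) : Prop :=
  [/\ concept_over L S D, entails O (CI C1 D) & entails O (CI D C2)].

(* [AssertC A a] is A(a) and [AssertR r a b] is r(a,b). *)
Inductive assertion :=
  | AssertC of name & name
  | AssertR of name & name & name.

Definition assertion_code (x : assertion) : name * name + name * name * name :=
  match x with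
  | AssertC A a => inl (A, a) | AssertR r a b => inr (r, a, b)
  end.
Definition assertion_decode (x : name * name + name * name * name) :=
  match x with
  | inl (A, a) => AssertC A a | inr (r, a, b) => AssertR r a b
  end.
Lemma assertion_codeK : cancel assertion_code assertion_decode.
Proof. by case. Qed.
HB.instance Definition _ := Equality.copy assertion (can_type assertion_codeK).

Definition database := seq assertion.

Definition ind (D : database) : seq name :=
  flatten [seq match x with
               | AssertC _ a => [:: a]
               | AssertR _ a b => [:: a; b]
               end | x <- D].

Definition holds (I : interp) (x : assertion) : Prop :=
  match x with
  | AssertC A a => I_concept A (I_ind I a)
  | AssertR r a b => I_role r (I_ind I a) (I_ind I b)
  end.

Definition kb_model (I : interp) (O : ontology) (D : database) : Prop :=
  model I O /\ (forall x, x \in D -> holds I x).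

Definition kb_entails (O : ontology) (D : database) (C : concept) (a : name) :=
  forall I : interp, kb_model I O D -> sem C (I_ind I a).

(* One half (positive or negative) of a labelled data set. *)
Definition examples := seq (database * name).

Definition wf_examples (P : examples) : bool :=
  all (fun e => e.2 \in ind e.1) P.

Definition separator (L : dl) (S : signature) (O : ontology)
    (P N : examples) (C : concept) : Prop :=
  [/\ concept_over L S C,
      forall D a, (D, a) \in P -> kb_entails O D C a &
      forall D a, (D, a) \in N -> kb_entails O D (Neg C) a].

(* Polynomial time is defined through first-order recursive programs on binary
   trees (pure Lisp with a single atom). A program is a list of function bodies
   with one argument each; evaluation starts with function 0. Every evaluation
   step is charged at least 1, and a step that copies or builds a tree is
   charged the full size of that tree, so that sharing cannot hide an
   exponentially large value. Hence running times agree with those of Turing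
   machines up to a polynomial. *)
Inductive tree := Leaf | Node of tree & tree.

Fixpoint tree_size (t : tree) : nat :=
  if t is Node l r then (tree_size l + tree_size r).+1 else 1.

Definition tleft (t : tree) : tree := if t is Node l _ then l else Leaf.
Definition tright (t : tree) : tree := if t is Node _ r then r else Leaf.

Inductive expr :=
  | EArg
  | ELeaf
  | ENode of expr & expr
  | ELeft of expr
  | ERight of expr
  | EIf of expr & expr & expr
  | ECall of nat & expr.

Definition program := seq expr.

Definition body (p : program) (f : nat) : expr := nth ELeaf p f.

(* [eval p x e v t]: with argument x, expression e has value v, in time t. *)
Inductive eval (p : program) : tree -> expr -> tree -> nat -> Prop :=
  | eval_arg x : eval p x EArg x (tree_size x)
  | eval_leaf x : eval p x ELeaf Leaf 1
  | eval_node x e1 e2 v1 v2 t1 t2 :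
      eval p x e1 v1 t1 -> eval p x e2 v2 t2 ->
      eval p x (ENode e1 e2) (Node v1 v2) (t1 + t2 + tree_size (Node v1 v2))
  | eval_left x e v t :
      eval p x e v t -> eval p x (ELeft e) (tleft v) (t + tree_size (tleft v))
  | eval_right x e v t :
      eval p x e v t ->
      eval p x (ERight e) (tright v) (t + tree_size (tright v))
  | eval_if_node x e e1 e2 l r w t t1 :
      eval p x e (Node l r) t -> eval p x e1 w t1 ->
      eval p x (EIf e e1 e2) w (t + t1).+1
  | eval_if_leaf x e e1 e2 w t t2 :
      eval p x e Leaf t -> eval p x e2 w t2 ->
      eval p x (EIf e e1 e2) w (t + t2).+1
  | eval_call x f e v w t t' :
      eval p x e v t -> eval p v (body p f) w t' ->
      eval p x (ECall f e) w (t + t').+1.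

(* Given any x satisfying [Pre], some y with [Post x y] can be constructed in
   time polynomial in the size of x. *)
Definition polytime_constructible (A B : Type)
    (encA : A -> tree) (encB : B -> tree)
    (Pre : A -> Prop) (Post : A -> B -> Prop) : Prop :=
  exists (p : program) (c k : nat), forall x : A, Pre x ->
    exists (y : B) (t : nat),
      [/\ eval p (encA x) (body p 0) (encB y) t,
          t <= c * tree_size (encA x) ^ k + c &
          Post x y].

Fixpoint numeral (n : nat) : tree := if n is m.+1 then Node Leaf (numeral m) else Leaf.

Definition enc_bool (b : bool) : tree := numeral b.

Definition enc_pair (A B : Type) (encA : A -> tree) (encB : B -> tree)
    (x : A * B) : tree := Node (encA x.1) (encB x.2).

Definition enc_seq (A : Type) (encA : A -> tree) (s : seq A) : tree :=
  foldr (fun x t => Node (encA x) t) Leaf s.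

Definition enc_name : name -> tree := enc_seq enc_bool.

Definition enc_role (r : role) : tree :=
  match r with
  | RName s => Node (numeral 0) (enc_name s)
  | RInv s => Node (numeral 1) (enc_name s)
  end.

Fixpoint enc_concept (C : concept) : tree :=
  match C with
  | Top => Node (numeral 0) Leaf
  | CName A => Node (numeral 1) (enc_name A)
  | Nominal a => Node (numeral 2) (enc_name a)
  | Neg C => Node (numeral 3) (enc_concept C)
  | And C D => Node (numeral 4) (Node (enc_concept C) (enc_concept D))
  | Ex r C => Node (numeral 5) (Node (enc_role r) (enc_concept C))
  | ExU C => Node (numeral 6) (enc_concept C)
  end.

Definition enc_inclusion (i : inclusion) : tree :=
  match i with
  | CI C D => Node (numeral 0) (Node (enc_concept C) (enc_concept D))
  | RI r s => Node (numeral 1) (Node (enc_role r) (enc_role s))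
  end.

Definition enc_ontology : ontology -> tree := enc_seq enc_inclusion.

Definition enc_symbol (s : symbol) : tree :=
  match s with
  | SConcept A => Node (numeral 0) (enc_name A)
  | SRole r => Node (numeral 1) (enc_name r)
  | SInd a => Node (numeral 2) (enc_name a)
  end.

Definition enc_signature : signature -> tree := enc_seq enc_symbol.

Definition enc_assertion (x : assertion) : tree :=
  match x with
  | AssertC A a => Node (numeral 0) (Node (enc_name A) (enc_name a))
  | AssertR r a b =>
      Node (numeral 1) (Node (enc_name r) (Node (enc_name a) (enc_name b)))
  end.

Definition enc_examples : examples -> tree :=
  enc_seq (enc_pair (enc_seq enc_assertion) enc_name).

Definition enc_OPN : ontology * examples * examples -> tree :=
  enc_pair (enc_pair enc_ontology enc_examples) enc_examples.

Definition enc_OPNS : ontology * examples * examples * signature -> tree :=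
  enc_pair enc_OPN enc_signature.

Definition enc_OOCC : ontology * ontology * concept * concept -> tree :=
  enc_pair (enc_pair (enc_pair enc_ontology enc_ontology) enc_concept)
    enc_concept.

(* Main.v *)
(* From separators to interpolants: let s be a fresh role name. The concept
   {a} and "Exists s.alpha for every assertion alpha of D" describes an example
   (D, a), because nominals turn assertions into concepts true everywhere or
   nowhere, and s can be read as the full relation. So C is a separator iff the
   ontology entails "some positive example" <= C <= "no negative example". Two
   copies of the ontology that share exactly the symbols of Sigma put this in
   the form of an interpolation problem: every model of the ontology expands to
   a model of both copies.

   From interpolants to separators: take a fresh individual a, fresh concept
   names A1 <= C1 and A2 <= not C2, the positive example {A1(a)} and the negative
   example {A2(a)}.

   Fresh names are obtained by making them longer than the whole input. *)

From Stdlib Require Import Classical_Prop.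
Require Import Defs.
From mathcomp Require Import all_boot zify.

Set Implicit Arguments.
Unset Strict Implicit.
Unset Printing Implicit Defensive.

(** * Polynomial-time functions on trees *)

(** The base [n.+2] is at least 2, so a single exponent absorbs constants, sums and products
    alike. *)
Definition poly (f : nat -> nat) := exists k, forall n, f n <= n.+2 ^ k.

Lemma leq_exp2S n j k : j <= k -> n.+2 ^ j <= n.+2 ^ k.
Proof. by move=> jk; rewrite leq_exp2l. Qed.

Lemma poly_le f g : (forall n, f n <= g n) -> poly g -> poly f.
Proof. by move=> fg [k gk]; exists k => n; apply: leq_trans (gk n). Qed.

Lemma poly_exp k : poly (fun n => n.+2 ^ k).
Proof. by exists k. Qed.

Lemma poly_id : poly id.
Proof. by exists 1 => n; rewrite expn1; lia. Qed.

Lemma poly_const c : poly (fun=> c).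
Proof.
exists c => n; apply: leq_trans (ltnW (ltn_expl c (ltnSn 1))) _.
by case: c => // c; rewrite leq_exp2r.
Qed.

Lemma poly_mul f g : poly f -> poly g -> poly (fun n => f n * g n).
Proof.
by move=> [j fj] [k gk]; exists (j + k) => n; rewrite expnD leq_mul.
Qed.

Lemma poly_add f g : poly f -> poly g -> poly (fun n => f n + g n).
Proof.
move=> [j fj] [k gk]; exists (j + k).+1 => n.
have := leq_trans (fj n) (leq_exp2S n (leq_addr k j)).
have := leq_trans (gk n) (leq_exp2S n (leq_addl j k)).
by rewrite expnS !mulSn; lia.
Qed.

Lemma poly_comp f k : poly f -> poly (fun n => (f n).+2 ^ k).
Proof.
move=> fp; have [j fj] : poly (fun n => f n + 2) by apply: poly_add (poly_const 2).
exists (j * k) => n; rewrite expnM; case: k => // k.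
by rewrite leq_exp2r // -addn2 fj.
Qed.

(** * Closure properties of polynomial-time functions *)

Lemma tree_size_gt0 t : 0 < tree_size t. Proof. by case: t. Qed.

Lemma size_tleft t : tree_size (tleft t) <= tree_size t.
Proof. by case: t => //= l r; lia. Qed.

Lemma size_tright t : tree_size (tright t) <= tree_size t.
Proof. by case: t => //= l r; lia. Qed.

(** Every step pays for the tree it copies or builds, so a time bound is also a size bound; this
    keeps compositions polynomial. *)
Lemma eval_size p x e v t : eval p x e v t -> tree_size v <= t.
Proof. by elim=> * /=; lia. Qed.

Definition computes (p : program) (e : expr) (F : tree -> tree) (k : nat) :=
  forall x, exists2 t, eval p x e (F x) t & t <= (tree_size x).+2 ^ k.

Definition code_at (a : nat) (C p : program) :=
  forall i, i < size C -> body p (a + i) = body C i.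

(* The code may be placed at any position [a] of a larger program, so that
   pieces of code can be linked without renumbering calls. *)
Definition ptime (F : tree -> tree) := exists k, forall a, exists C e, forall p,
  code_at a C p -> computes p e F k.

Lemma code_at_cat a C D p : code_at a (C ++ D) p ->
  code_at a C p /\ code_at (a + size C) D p.
Proof.
move=> H; split=> i lti; have := H (_ + i).
  by move/(_ 0); rewrite add0n size_cat /body nth_cat lti => -> //; lia.
move/(_ (size C)); rewrite size_cat ltn_add2l addnA => -> //.
by rewrite /body nth_cat ltnNge leq_addr addKn.
Qed.

Lemma code_at_cons a e C p : code_at a (e :: C) p ->
  body p a = e /\ code_at a.+1 C p.
Proof.
move=> H; split=> [|i lti]; first by have := H 0 isT; rewrite addn0.
by have := H i.+1 lti; rewrite addnS.
Qed.

Lemma ptime_ext F G : F =1 G -> ptime F -> ptime G.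
Proof.
move=> FG [k Fk]; exists k => a; have [C [e H]] := Fk a.
by exists C, e => p pC x; rewrite -FG; apply: H.
Qed.

Lemma ptime_size F : ptime F ->
  exists k, forall x, tree_size (F x) <= (tree_size x).+2 ^ k.
Proof.
move=> [k Fk]; exists k => x; have [C [e H]] := Fk 0.
by have [//|t /eval_size le1 le2] := H C _ x; apply: leq_trans le2.
Qed.

Lemma ptime_intro F (T : nat -> nat) : poly T ->
  (forall a, exists C e, forall p, code_at a C p -> forall x,
     exists2 t, eval p x e (F x) t & t <= T (tree_size x)) ->
  ptime F.
Proof.
move=> [k Tk] H; exists k => a; have [C [e He]] := H a.
exists C, e => p pC x; have [t ev le] := He p pC x.
by exists t => //; apply: leq_trans (Tk _).
Qed.

Lemma ptime_arg : ptime id.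
Proof.
apply: (ptime_intro poly_id) => a; exists [::], EArg => p _ x.
by exists (tree_size x) => //; constructor.
Qed.

Lemma ptime_leaf : ptime (fun=> Leaf).
Proof.
apply: (ptime_intro (poly_const 1)) => a; exists [::], ELeaf => p _ x.
by exists 1 => //; constructor.
Qed.

Lemma ptime_node F G : ptime F -> ptime G -> ptime (fun x => Node (F x) (G x)).
Proof.
move=> [j Fj] [k Gk].
pose T n := 2 * n.+2 ^ j + 2 * n.+2 ^ k + 1.
apply: (@ptime_intro _ T) => [|a].
  apply: poly_add (poly_const 1); apply: poly_add; apply: poly_mul (poly_exp _);
  exact: poly_const.
have [C1 [e1 H1]] := Fj a; have [C2 [e2 H2]] := Gk (a + size C1).
exists (C1 ++ C2), (ENode e1 e2) => p /code_at_cat[/H1{}H1 /H2{}H2] x.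
have [t1 ev1 le1] := H1 x; have [t2 ev2 le2] := H2 x.
eexists; first exact: eval_node ev1 ev2.
have := eval_size ev1; have := eval_size ev2; rewrite /T /=; lia.
Qed.

Lemma ptime_left F : ptime F -> ptime (fun x => tleft (F x)).
Proof.
move=> [k Fk]; apply: (@ptime_intro _ (fun n => 2 * n.+2 ^ k)) => [|a].
  by apply: poly_mul (poly_exp _); exact: poly_const.
have [C [e H]] := Fk a; exists C, (ELeft e) => p /H{}H x.
have [t ev le] := H x; eexists; first exact: eval_left ev.
have := eval_size ev; have := size_tleft (F x); lia.
Qed.

Lemma ptime_right F : ptime F -> ptime (fun x => tright (F x)).
Proof.
move=> [k Fk]; apply: (@ptime_intro _ (fun n => 2 * n.+2 ^ k)) => [|a].
  by apply: poly_mul (poly_exp _); exact: poly_const.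
have [C [e H]] := Fk a; exists C, (ERight e) => p /H{}H x.
have [t ev le] := H x; eexists; first exact: eval_right ev.
have := eval_size ev; have := size_tright (F x); lia.
Qed.

Lemma ptime_if F G H : ptime F -> ptime G -> ptime H ->
  ptime (fun x => if F x is Node _ _ then G x else H x).
Proof.
move=> [i Fi] [j Gj] [k Hk].
pose T n := n.+2 ^ i + n.+2 ^ j + n.+2 ^ k + 1.
apply: (@ptime_intro _ T) => [|a].
  apply: poly_add (poly_const 1); do !apply: poly_add; exact: poly_exp.
have [C1 [e1 H1]] := Fi a; have [C2 [e2 H2]] := Gj (a + size C1).
have [C3 [e3 H3]] := Hk (a + size C1 + size C2).
exists (C1 ++ C2 ++ C3), (EIf e1 e2 e3) => p.
move=> /code_at_cat[/H1{}H1 /code_at_cat[/H2{}H2 /H3{}H3]] x.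
have [t1 ev1 le1] := H1 x; have [t2 ev2 le2] := H2 x; have [t3 ev3 le3] := H3 x.
case: (F x) ev1 => [|l r] ev1; eexists.
- exact: eval_if_leaf ev1 ev3.
- by rewrite /T; lia.
- exact: eval_if_node ev1 ev2.
- by rewrite /T; lia.
Qed.

Lemma ptime_comp F G : ptime G -> ptime F -> ptime (fun x => G (F x)).
Proof.
move=> [k Gk] [j Fj].
pose T n := n.+2 ^ j + (n.+2 ^ j).+2 ^ k + 1.
apply: (@ptime_intro _ T) => [|a].
  apply: poly_add (poly_const 1); apply: poly_add; first exact: poly_exp.
  exact/poly_comp/poly_exp.
have [C1 [e1 H1]] := Fj a; have [C2 [e2 H2]] := Gk (a + size C1).
(* The expression for [G] becomes the body of a function of its own, behind the code of both, so
   that [ECall] can pass it [F x] as argument. *)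
exists (C1 ++ C2 ++ [:: e2]), (ECall (a + size C1 + size C2) e1) => p.
move=> /code_at_cat[/H1{}H1 /code_at_cat[/H2{}H2 /code_at_cons[be2 _]]] x.
have [t1 ev1 le1] := H1 x; have [t2 ev2 le2] := H2 (F x).
rewrite -be2 in ev2; eexists; first exact: eval_call ev1 ev2.
have szF := leq_trans (eval_size ev1) le1.
have : (tree_size (F x)).+2 ^ k <= ((tree_size x).+2 ^ j).+2 ^ k.
  by case: (k) => // k'; rewrite leq_exp2r.
rewrite /T; lia.
Qed.

Lemma ptime_const t : ptime (fun=> t).
Proof. by elim: t => [|l pl r pr]; [exact: ptime_leaf | exact: ptime_node]. Qed.

(* Recursion on the left component of the argument: the number of calls is
   bounded by the size of that component, and their cost by the polynomial
   bounds on the sizes of arguments and results. *)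
Lemma ptime_rec F g1 g2 b s c :
  ptime g1 -> ptime g2 -> ptime b -> ptime s ->
  (forall x, F x = if tleft x is Node _ _ then
                     s (Node x (Node (F (g1 x)) (F (g2 x)))) else b x) ->
  (forall x, tleft x <> Leaf ->
     [/\ tree_size (tleft (g1 x)) + tree_size (tleft (g2 x)) < tree_size (tleft x),
         tree_size (g1 x) <= tree_size x + c & tree_size (g2 x) <= tree_size x + c]) ->
  (exists k, forall x, tree_size (F x) <= (tree_size x).+2 ^ k) ->
  ptime F.
Proof.
move=> [k1 G1] [k2 G2] [kb Gb] [ks Gs] Feq dec [kF szF].
(* [V] bounds the argument handed to [s], [M] the cost of one unfolding apart from its recursive
   calls, and [T] adds up at most [n] unfoldings on arguments of size at most [n + c * n]. *)
pose V n := 2 * n.+2 ^ kF + n + 2.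
pose M n := 6 * n + 2 * V n + n.+2 ^ k1 + n.+2 ^ k2 + n.+2 ^ kb + (V n).+2 ^ ks + 10.
pose T n := M (n + c * n) * n.
have polyV : poly V.
  apply: poly_add (poly_const _); apply: poly_add (poly_id).
  by apply: poly_mul (poly_const _) (poly_exp _).
have polyM : poly M.
  apply: poly_add (poly_const _); apply: poly_add; last exact: poly_comp.
  do !(apply: poly_add; last exact: poly_exp).
  by apply: poly_add; apply: poly_mul (poly_const _) _; [exact: poly_id|].
apply: (@ptime_intro _ T) => [|a].
  apply: poly_mul (poly_id); have [m Mm] := polyM.
  apply: (@poly_le _ (fun n => (n + c * n).+2 ^ m)) => [n|]; first exact: Mm.
  apply: poly_comp; apply: poly_add; first exact: poly_id.
  exact: poly_mul (poly_const _) poly_id.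
have [C1 [e1 H1]] := G1 a; have [C2 [e2 H2]] := G2 (a + size C1).
have [Cb [eb Hb]] := Gb (a + size C1 + size C2).
have [Cs [es Hs]] := Gs (a + size C1 + size C2 + size Cb).
(* Function [j] is [e] itself, which closes the recursion; function [j.+1] is the code of [s]. *)
pose j := a + size C1 + size C2 + size Cb + size Cs.
pose e := EIf (ELeft EArg)
  (ECall j.+1 (ENode EArg (ENode (ECall j e1) (ECall j e2)))) eb.
exists (C1 ++ C2 ++ Cb ++ Cs ++ [:: e; es]), e => p.
move=> /code_at_cat[/H1{}H1 /code_at_cat[/H2{}H2 /code_at_cat[/Hb{}Hb]]].
move=> /code_at_cat[/Hs{}Hs /code_at_cons[bj /code_at_cons[bj1 _]]].
have mono k m n : m <= n -> m.+2 ^ k <= n.+2 ^ k.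
  by case: k => // k mn; rewrite leq_exp2r.
(* A call adds at most [c] to the size of the argument but takes at least one from the left
   component, so the sum bounded by [N] never grows. The left components of both calls together are
   strictly smaller, which frees one [M N] for the present unfolding. *)
have main N m x : tree_size (tleft x) <= m ->
    tree_size x + c * tree_size (tleft x) <= N ->
    exists2 t, eval p x e (F x) t & t <= M N * tree_size (tleft x).
  elim: m x => [|m IH] x mx Nx; first by have := tree_size_gt0 (tleft x); lia.
  have xN : tree_size x <= N by lia.
  have evl := eval_left (eval_arg p x).
  have lx := size_tleft x.
  have := Feq x; have := dec x; case El: (tleft x) evl mx Nx => [|l r] evl mx Nx.
    move=> _ Ex; have [t ev le] := Hb x.
    exists ((tree_size x + tree_size Leaf + t).+1).
      by rewrite Ex; apply: eval_if_leaf ev.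
    by have := mono kb _ _ xN; rewrite /M /=; lia.
  case=> // lt12 sz1 sz2 Ex.
  have gt1 := tree_size_gt0 (tleft (g1 x)); have gt2 := tree_size_gt0 (tleft (g2 x)).
  have [||t1 ev1 le1] := IH (g1 x); [by lia | by nia |].
  have [||t2 ev2 le2] := IH (g2 x); [by lia | by nia |].
  have [u1 eu1 ule1] := H1 x; have [u2 eu2 ule2] := H2 x.
  have N1 : tree_size (g1 x) <= N by nia.
  have N2 : tree_size (g2 x) <= N by nia.
  have f1 := leq_trans (szF (g1 x)) (mono kF _ _ N1).
  have f2 := leq_trans (szF (g2 x)) (mono kF _ _ N2).
  set y := Node x _ in Ex.
  have yV : tree_size y <= V N by rewrite /y /V /=; lia.
  have [ts evs les] := Hs y.
  have evc1 : eval p x (ECall j e1) (F (g1 x)) (u1 + t1).+1.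
    by apply: eval_call eu1 _; rewrite bj.
  have evc2 : eval p x (ECall j e2) (F (g2 x)) (u2 + t2).+1.
    by apply: eval_call eu2 _; rewrite bj.
  have evy := eval_node (eval_arg p x) (eval_node evc1 evc2).
  rewrite -bj1 in evs.
  eexists; first by rewrite Ex; apply: eval_if_node evl (eval_call evy evs).
  have := mono k1 _ _ xN; have := mono k2 _ _ xN; have := mono ks _ _ yV.
  have VN : tree_size (Node (F (g1 x)) (F (g2 x))) <= V N by rewrite /V /=; lia.
  have : M N * (tree_size (tleft (g1 x)) + tree_size (tleft (g2 x))).+1
         <= M N * tree_size (Node l r) by rewrite leq_mul2l lt12 orbT.
  rewrite mulnSr mulnDr => leM m1 m2 m3.
  apply: leq_trans leM.
  have le12 := leq_add le1 le2.
  rewrite El in lx; rewrite -/y; clearbody y.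
  suff : ((tree_size x + tree_size (Node l r)) + (tree_size x + ((u1 + 0).+1 + (u2 + 0).+1 +
    tree_size (Node (F (g1 x)) (F (g2 x)))) + tree_size y + ts).+1).+1 <= M N.
    by move: le12; move: (M N * _) (M N * _) => ? ?; lia.
  rewrite /M; lia.
move=> x; have [|t ev le] := main (tree_size x + c * tree_size x) _ x (leqnn _).
  by rewrite leq_add2l leq_mul2l size_tleft orbT.
by exists t => //; apply: leq_trans le _; rewrite /T leq_mul2l size_tleft orbT.
Qed.

(** Evaluation starts with function 0, so the main expression goes there and its auxiliary code is
    linked from position 1. *)
Lemma ptime_constructible (A B : Type) (encA : A -> tree) (encB : B -> tree)
    (Pre : A -> Prop) (Post : A -> B -> Prop) (F : tree -> tree) (f : A -> B) :
  ptime F -> (forall x, F (encA x) = encB (f x)) ->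
  (forall x, Pre x -> Post x (f x)) ->
  polytime_constructible encA encB Pre Post.
Proof.
move=> [k Fk] Ff post; have [C [e H]] := Fk 1.
(* Trees have positive size [n], and then [n.+2 <= 3 * n]. *)
exists (e :: C), (3 ^ k), k => x /post Px; exists (f x).
have [//|t ev le] := H (e :: C) _ (encA x).
exists t; split=> //; first by rewrite -Ff.
apply: leq_trans le (leq_trans _ (leq_addr _ _)); rewrite -expnMn.
by have := tree_size_gt0 (encA x); case: k {Fk H} => // k ?; rewrite leq_exp2r; lia.
Qed.

Ltac ptime_step := first
  [ exact: ptime_const | exact: ptime_arg | exact: ptime_leaf
  | apply: ptime_node | apply: ptime_left | apply: ptime_right
  | apply: ptime_if | eassumption ].
Ltac ptime := repeat ptime_step.

(** * Lists, numerals and equality on trees *)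

Fixpoint tapp (a b : tree) : tree :=
  if a is Node h t then Node h (tapp t b) else b.

Lemma size_tapp a b : tree_size (tapp a b) < tree_size a + tree_size b.
Proof. by elim: a => [|h _ t IH] //=; lia. Qed.

Lemma ptime_tapp F G : ptime F -> ptime G -> ptime (fun x => tapp (F x) (G x)).
Proof.
move=> pF pG; have H : ptime (fun x => tapp (tleft x) (tright x)).
  (* A list takes one recursive call; the second goes to the dummy [Leaf], whose left component
     counts 1 and is paid for by the head. *)
  apply: (@ptime_rec _ (fun x => Node (tright (tleft x)) (tright x)) (fun=> Leaf)
    tright (fun z => Node (tleft (tleft (tleft z))) (tleft (tright z))) 0); ptime.
  - by case=> [|[|h t] y].
  - by case=> [|[|h t] y] //= _; have := tree_size_gt0 h; split; lia.
  - by exists 1 => -[|l r] /=; rewrite expn1 //; have := size_tapp l r; lia.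
by apply: (ptime_ext _ (ptime_comp H (ptime_node pF pG))).
Qed.

Lemma tree_size_numeral n : tree_size (numeral n) = n.*2.+1.
Proof. by elim: n => //= n ->; lia. Qed.

Lemma tapp_numeral m n : tapp (numeral m) (numeral n) = numeral (m + n).
Proof. by elim: m => //= m ->. Qed.

(** Read as a word, this numeral is a name as long as the tree is large; it supplies the fresh
    names. *)
Lemma ptime_numeral_size F : ptime F -> ptime (fun x => numeral (tree_size (F x))).
Proof.
move=> pF; have H : ptime (fun x => numeral (tree_size (tleft x))).
  apply: (@ptime_rec _ (fun x => Node (tleft (tleft x)) Leaf)
    (fun x => Node (tright (tleft x)) Leaf) (fun=> numeral 1)
    (fun z => Node Leaf (tapp (tleft (tright z)) (tright (tright z)))) 0);
    ptime; first by apply: ptime_tapp; ptime.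
  - by case=> [|[|l r] y] //=; rewrite tapp_numeral.
  - by case=> [|[|l r] y] //= _; split; have := tree_size_gt0 y; lia.
  - exists 2 => x; rewrite tree_size_numeral; have := size_tleft x.
    by rewrite expnS expn1; nia.
by apply: (ptime_ext _ (ptime_comp H (ptime_node pF (ptime_const Leaf)))).
Qed.

Fixpoint teq (a b : tree) : bool :=
  match a, b with
  | Leaf, Leaf => true
  | Node a1 a2, Node b1 b2 => teq a1 b1 && teq a2 b2
  | _, _ => false
  end.

Lemma teqP a b : reflect (a = b) (teq a b).
Proof.
elim: a b => [|a1 IH1 a2 IH2] [|b1 b2] /=; try by constructor.
by apply: (iffP andP) => [[/IH1-> /IH2->] | [/IH1 ? /IH2 ?]].
Qed.

Lemma size_enc_bool b n : tree_size (enc_bool b) <= n.+2 ^ 2.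
Proof. by case: b; rewrite /= expnS expn1; nia. Qed.

Lemma ptime_teq F G : ptime F -> ptime G -> ptime (fun x => enc_bool (teq (F x) (G x))).
Proof.
move=> pF pG; have H : ptime (fun x => enc_bool (teq (tleft x) (tright x))).
  apply: (@ptime_rec _
    (fun x => Node (tleft (tleft x)) (tleft (tright x)))
    (fun x => Node (tright (tleft x)) (tright (tright x)))
    (fun x => if tright x is Node _ _ then Leaf else numeral 1)
    (fun z => if tright (tleft z) is Node _ _ then
                if tleft (tright z) is Node _ _ then tright (tright z) else Leaf
              else Leaf) 0); ptime.
  - by case=> [|[|l r] [|l' r']] //=; case: teq.
  - by case=> [|[|l r] y] //= _; have := size_tleft y; have := size_tright y; split; lia.
  - by exists 2 => x; exact: size_enc_bool.
by apply: (ptime_ext _ (ptime_comp H (ptime_node pF pG))).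
Qed.

Fixpoint tmem (e l : tree) : bool :=
  if l is Node h t then teq e h || tmem e t else false.

Lemma ptime_tmem F G : ptime F -> ptime G -> ptime (fun x => enc_bool (tmem (F x) (G x))).
Proof.
move=> pF pG; have H : ptime (fun x => enc_bool (tmem (tright x) (tleft x))).
  apply: (@ptime_rec _
    (fun x => Node (tright (tleft x)) (tright x)) (fun=> Leaf) (fun=> Leaf)
    (fun z => if enc_bool (teq (tright (tleft z)) (tleft (tleft (tleft z)))) is Node _ _
              then numeral 1 else tleft (tright z)) 0); ptime.
  - by apply: ptime_teq; ptime.
  - by case=> [|[|l r] y] //=; case: teq.
  - by case=> [|[|l r] y] //= _; have := tree_size_gt0 l; split; lia.
  - by exists 2 => x; exact: size_enc_bool.
by apply: (ptime_ext _ (ptime_comp H (ptime_node pG pF))).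
Qed.

(** Functions of a program take one argument and have no closures, so the environment [e] is paired
    with each element. *)
Fixpoint tmap (G : tree -> tree) (e l : tree) : tree :=
  if l is Node h t then Node (G (Node e h)) (tmap G e t) else Leaf.

Lemma ptime_tmap G F1 F2 : ptime G -> ptime F1 -> ptime F2 ->
  ptime (fun x => tmap G (F1 x) (F2 x)).
Proof.
move=> pG p1 p2; have H : ptime (fun x => tmap G (tright x) (tleft x)).
  apply: (@ptime_rec _
    (fun x => Node (tright (tleft x)) (tright x)) (fun=> Leaf) (fun=> Leaf)
    (fun z => Node (G (Node (tright (tleft z)) (tleft (tleft (tleft z)))))
                   (tleft (tright z))) 0); ptime.
  - by apply: ptime_comp pG _; ptime.
  - by case=> [|[|l r] y].
  - by case=> [|[|l r] y] //= _; have := tree_size_gt0 l; split; lia.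
  have [k szG] := ptime_size pG.
  have [m Hm] : poly (fun n => n * (n.+2 ^ k + 1)).
    apply: poly_mul poly_id _; apply: poly_add (poly_exp _) (poly_const _).
  exists m => -[|l e] /=; first by rewrite expn_gt0.
  apply: leq_trans (Hm _).
  (* [n] stays fixed along the list, so that one bound serves the value of [G] at every element. *)
  suff le n : tree_size l + tree_size e <= n ->
      tree_size (tmap G e l) <= tree_size l * (n.+2 ^ k + 1).
    by apply: leq_trans (le _ (leqnSn _)) _; rewrite leq_mul2r; apply/orP; right; lia.
  elim: l => [|h _ t IH] /= le; first by lia.
  have /IH{}IH : tree_size t + tree_size e <= n by lia.
  have : tree_size (G (Node e h)) <= n.+2 ^ k.
    apply: leq_trans (szG _) _; case: (k) => // k'.
    by rewrite leq_exp2r //=; have := tree_size_gt0 t; lia.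
  by have := tree_size_gt0 h; nia.
by apply: (ptime_ext _ (ptime_comp H (ptime_node p2 p1))).
Qed.

(** The tags 4 and 0 are those of [And] and [Top]: this is iterated conjunction on encodings. *)
Fixpoint tconj (l : tree) : tree :=
  if l is Node u v then Node (numeral 4) (Node u (tconj v))
  else Node (numeral 0) Leaf.

Lemma ptime_tconj F : ptime F -> ptime (fun x => tconj (F x)).
Proof.
move=> pF; have H : ptime (fun x => tconj (tleft x)).
  apply: (@ptime_rec _
    (fun x => Node (tright (tleft x)) Leaf) (fun=> Leaf) (fun=> tconj Leaf)
    (fun z => Node (numeral 4) (Node (tleft (tleft (tleft z))) (tleft (tright z)))) 0); ptime.
  - by case=> [|[|l r] y].
  - by case=> [|[|l r] y] //= _; have := tree_size_gt0 l; have := tree_size_gt0 y; split; lia.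
  have [m Hm] : poly (fun n => n * 20) := poly_mul poly_id (poly_const 20).
  exists m => x; apply: leq_trans (Hm _).
  suff: tree_size (tconj (tleft x)) <= tree_size (tleft x) * 20.
    by have := size_tleft x; lia.
  by elim: (tleft x) => [|u _ v IH] //=; have := tree_size_gt0 u; lia.
by apply: (ptime_ext _ (ptime_comp H (ptime_node pF (ptime_const Leaf)))).
Qed.

(** * Table look-up and the renaming automaton *)

Fixpoint pick (d : tree) (bs : seq tree) (t : tree) : tree :=
  if bs is b :: bs then if t is Node _ t then pick d bs t else b else d.

(** The table belongs to the program: a look-up is a fixed nest of conditionals along the right
    spine of [F x]. *)
Lemma ptime_pick d bs F : ptime F -> ptime (fun x => pick d bs (F x)).
Proof.
elim: bs F => [|b bs IH] F pF; first exact: ptime_const.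
have /IH{}IH : ptime (fun x => tright (F x)) by ptime.
by apply: (ptime_ext _ (ptime_if pF IH (ptime_const b))) => x /=; case: (F x).
Qed.

(** Uniformity in [t] bounds the states of the automaton, which gives the growth constant [c] of
    [ptime_rec]. *)
Lemma size_pick d bs : exists c, forall t, tree_size (pick d bs t) <= c.
Proof.
elim: bs => [|b bs [c H]]; first by exists (tree_size d).
by exists (c + tree_size b) => -[|_ t] /=; [lia | have := H t; lia].
Qed.

Fixpoint pick2 (d : tree) (rows : seq (tree * seq tree)) (q t : tree) : tree :=
  if rows is r :: rows then
    if q is Node _ q then pick2 d rows q t else pick r.1 r.2 t
  else d.

Lemma ptime_pick2 d rows F G : ptime F -> ptime G ->
  ptime (fun x => pick2 d rows (F x) (G x)).
Proof.
move=> pF pG; elim: rows F pF => [|r rows IH] F pF; first exact: ptime_const.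
have /IH{}IH : ptime (fun x => tright (F x)) by ptime.
have pr := @ptime_pick r.1 r.2 _ pG.
by apply: (ptime_ext _ (ptime_if pF IH pr)) => x /=; case: (F x).
Qed.

Lemma size_pick2 d rows : exists c, forall q t, tree_size (pick2 d rows q t) <= c.
Proof.
elim: rows => [|r rows [c H]]; first by exists (tree_size d).
have [c' H'] := size_pick r.1 r.2.
by exists (c + c') => -[|_ q] t /=; [have := H' t; lia | have := H q t; lia].
Qed.

(** [k] is the tag of a kind of symbol, so [Node k n] encodes a symbol and equal names of different
    kinds are kept apart. *)
Definition trename_name (S w k n : tree) : tree :=
  if tmem (Node k n) S then n else tapp w n.

(* Renaming walks down an encoding with a finite automaton that knows which
   syntactic category the current subtree encodes; its transitions depend on
   the constructor tag found in the left subtree. *)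
Definition st_name (k : nat) := Node (numeral 1) (numeral k).
Definition st (q : nat) := Node Leaf (numeral q).
Definition st_skip := st 0.
Definition st_concept := st 1.
Definition st_concepts := st 2.
Definition st_role := st 3.
Definition st_role_concept := st 4.
Definition st_inclusion := st 5.
Definition st_roles := st 6.
Definition st_ontology := st 7.

(** The entries belong to [st 0] up to [st 7] in this order. A constructor tag sits on the left and
    is copied under [st_skip]. *)
Definition next_left (q : tree) : tree :=
  pick st_skip
    [:: st_skip; st_skip; st_concept; st_skip; st_role; st_skip; st_role;
        st_inclusion] q.

(** Each row holds a default and a table by tag; only the rows of concepts and inclusions consult
    the tag, in the numbering of the constructors. *)
Definition next_right (q tag : tree) : tree :=
  pick2 st_skip
    [:: (st_skip, [::]);
        (st_skip, [:: st_skip; st_name 0; st_name 2; st_concept; st_concepts;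
                      st_role_concept; st_concept]);
        (st_concept, [::]);
        (st_name 1, [::]);
        (st_concept, [::]);
        (st_skip, [:: st_concepts; st_roles]);
        (st_role, [::]);
        (st_ontology, [::])] q tag.

Fixpoint trename (S w a q : tree) : tree :=
  if tleft q is Node _ _ then trename_name S w (tright q) a
  else if a is Node l r then
    Node (trename S w l (next_left (tright q)))
         (trename S w r (next_right (tright q) l))
  else Leaf.

(** Names occupy disjoint subtrees, and each grows by less than the size of [w]. *)
Lemma size_trename S w a q :
  tree_size (trename S w a q) <= tree_size a * (tree_size w).+1.
Proof.
have name k b : tree_size (trename_name S w k b) <= tree_size b * (tree_size w).+1.
  rewrite /trename_name; have := size_tapp w b; have := tree_size_gt0 b.
  by case: tmem; nia.
elim: a q => [|l IHl r IHr] [|[|? ?] q] /=; try exact: name; try lia.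
- by have := IHl (next_left Leaf); have := IHr (next_right Leaf l); rewrite /=; nia.
- by have := IHl (next_left q); have := IHr (next_right q l); rewrite /=; nia.
Qed.

Lemma ptime_trename_name F1 F2 F3 F4 : ptime F1 -> ptime F2 -> ptime F3 -> ptime F4 ->
  ptime (fun x => trename_name (F1 x) (F2 x) (F3 x) (F4 x)).
Proof.
move=> p1 p2 p3 p4.
have pm : ptime (fun x => enc_bool (tmem (Node (F3 x) (F4 x)) (F1 x))).
  by apply: ptime_tmem; ptime.
apply: (ptime_ext _ (ptime_if pm p4 (ptime_tapp p2 p4))) => x.
by rewrite /trename_name; case: tmem.
Qed.

Lemma ptime_trename F1 F2 F3 F4 : ptime F1 -> ptime F2 -> ptime F3 -> ptime F4 ->
  ptime (fun x => trename (F1 x) (F2 x) (F3 x) (F4 x)).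
Proof.
move=> p1 p2 p3 p4.
(* The argument holds the tree to be walked, then the state, then the constant pair of signature and
   prefix. *)
pose sg x := tleft (tright (tright x)); pose wd x := tright (tright (tright x)).
pose q x := tleft (tright x).
have psg : ptime sg by rewrite /sg; ptime.
have pwd : ptime wd by rewrite /wd; ptime.
have pq : ptime q by rewrite /q; ptime.
have pname : ptime (fun x => trename_name (sg x) (wd x) (tright (q x)) (tleft x)).
  by apply: ptime_trename_name; ptime.
have H : ptime (fun x => trename (sg x) (wd x) (tleft x) (q x)).
  have [c1 sz1] : exists c, forall t, tree_size (next_left t) <= c by exact: size_pick.
  have [c2 sz2] : exists c, forall t t', tree_size (next_right t t') <= c.
    exact: size_pick2.
  apply: (@ptime_rec _
    (fun x => Node (tleft (tleft x))
                (Node (next_left (tright (q x))) (tright (tright x))))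
    (fun x => Node (tright (tleft x))
                (Node (next_right (tright (q x)) (tleft (tleft x))) (tright (tright x))))
    (fun x => if tleft (q x) is Node _ _ then
                trename_name (sg x) (wd x) (tright (q x)) (tleft x) else Leaf)
    (* A name is replaced as a whole: the recursion scheme descends into it all the same, and both
       results are discarded. *)
    (fun z => if tleft (q (tleft z)) is Node _ _ then
                trename_name (sg (tleft z)) (wd (tleft z)) (tright (q (tleft z)))
                  (tleft (tleft z))
              else tright z) (c1 + c2 + 10)).
  - by ptime; apply: ptime_pick; ptime.
  - by ptime; apply: ptime_pick2; ptime.
  - by ptime.
  - have pq' : ptime (fun z => q (tleft z)) by apply: (ptime_comp pq); ptime.
    apply: ptime_if; ptime.
    by apply: (ptime_comp pname); ptime.
  - by move=> x /=; rewrite /sg /wd /q; case: (tleft x).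
  - move=> x; have := sz1 (tright (q x)).
    have := sz2 (tright (q x)) (tleft (tleft x)).
    move: (next_left _) (next_right _ _) => nl nr.
    by case: x => [|[|l r] [|p env]] //= ? ? _; split; lia.
  exists 3 => x; apply: leq_trans (size_trename _ _ _ _) _.
  have := size_tright (tright (tright x)); have := size_tright (tright x).
  have := size_tright x; have := size_tleft x; rewrite -/(wd x) => a1 a2 a3 a4.
  have : tree_size (tleft x) * (tree_size (wd x)).+1 <= (tree_size x).+2 * (tree_size x).+2.
    by apply: leq_mul; lia.
  by rewrite !expnS expn0; nia.
have pn := ptime_node p3 (ptime_node p4 (ptime_node p1 p2)).
by apply: (ptime_ext _ (ptime_comp H pn)).
Qed.

(** * Examples and disjoint copies of ontologies *)

Definition sname (s : symbol) : seq bool :=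
  match s with SConcept x | SRole x | SInd x => x end.

(** One dependent function collects the three parts of an interpretation, so that agreement on a
    signature is one equation per symbol. *)
Definition value (T : Type) (s : symbol) : Type :=
  match s with
  | SConcept _ => T -> Prop
  | SRole _ => T -> T -> Prop
  | SInd _ => T
  end.

Definition interp_of (T : Type) (v : forall s, value T s) : interp :=
  Interp (fun A => v (SConcept A)) (fun r => v (SRole r)) (fun a => v (SInd a)).

Lemma interp_ofP (I : interp) : exists T (v : forall s, value T s), I = interp_of v.
Proof.
case: I => T ic ir ii; exists T.
by exists (fun s =>
  match s return value T s with
  | SConcept A => ic A | SRole r => ir r | SInd a => ii a
  end).
Qed.

Definition sig_ontology (O : ontology) : signature := flatten (map sig_inclusion O).

(** * Dependence of the semantics on the occurring symbols only *)

Section Agreement.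
Variables (T : Type) (v v' : forall s, value T s).

Lemma role_agree (r : role) (d e : T) : {in sig_role r, forall s, v s = v' s} ->
  @role_sem (interp_of v) r d e <-> @role_sem (interp_of v') r d e.
Proof. by case: r => r /= H; rewrite H ?mem_head. Qed.

Lemma sem_agree (C : concept) (d : T) : {in sig_concept C, forall s, v s = v' s} ->
  @sem (interp_of v) C d <-> @sem (interp_of v') C d.
Proof.
elim: C d => [|A|a|C IH|C IHC D IHD|r C IH|C IH] d //= H.
- by rewrite H ?mem_head.
- by rewrite H ?mem_head.
- by rewrite IH.
- rewrite IHC ?IHD // => s Hs; apply: H; rewrite mem_cat Hs ?orbT //.
- have rE e : @role_sem (interp_of v) r d e <-> @role_sem (interp_of v') r d e.
    by apply: role_agree => s Hs; apply: H; rewrite mem_cat Hs.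
  have CE e : @sem (interp_of v) C e <-> @sem (interp_of v') C e.
    by apply: IH => s Hs; apply: H; rewrite mem_cat Hs orbT.
  by split=> -[e /rE re /CE Ce]; exists e.
- by split=> -[e He]; exists e; move: He; rewrite IH.
Qed.

Lemma satisfies_agree (i : inclusion) : {in sig_inclusion i, forall s, v s = v' s} ->
  satisfies (interp_of v) i <-> satisfies (interp_of v') i.
Proof.
case: i => [C D|r s] /= H.
  have CE d : @sem (interp_of v) C d <-> @sem (interp_of v') C d.
    by apply: sem_agree => x Hx; apply: H; rewrite mem_cat Hx.
  have DE d : @sem (interp_of v) D d <-> @sem (interp_of v') D d.
    by apply: sem_agree => x Hx; apply: H; rewrite mem_cat Hx orbT.
  by split=> CD d /CE /CD /DE.
have rE d e : @role_sem (interp_of v) r d e <-> @role_sem (interp_of v') r d e.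
  by apply: role_agree => x Hx; apply: H; rewrite mem_cat Hx.
have sE d e : @role_sem (interp_of v) s d e <-> @role_sem (interp_of v') s d e.
  by apply: role_agree => x Hx; apply: H; rewrite mem_cat Hx orbT.
by split=> rs d e /rE /rs /sE.
Qed.

Lemma model_agree (O : ontology) : {in sig_ontology O, forall s, v s = v' s} ->
  model (interp_of v) O <-> model (interp_of v') O.
Proof.
elim: O => [|i O IH] //= H.
rewrite satisfies_agree => [|s Hs]; last by apply: H; rewrite mem_cat Hs.
by rewrite IH // => s Hs; apply: H; rewrite mem_cat Hs orbT.
Qed.

End Agreement.

Lemma model_cat (I : interp) (O O' : ontology) :
  model I (O ++ O') <-> model I O /\ model I O'.
Proof. by elim: O => [|i O /= ->]; [split=> [|[]] | rewrite and_assoc]. Qed.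

(** * Examples as concepts *)

Definition conj_concept : seq concept -> concept := foldr And Top.

Lemma sem_conj (X : eqType) (I : interp) (g : X -> concept) (l : seq X) (d : dom I) :
  sem (conj_concept (map g l)) d <-> (forall x, x \in l -> sem (g x) d).
Proof.
elim: l => [|y l IH] //=; rewrite IH; split=> [[gy H] x|H].
  by rewrite inE => /predU1P[->|/H].
by split=> [|x xl]; apply: H; rewrite inE ?eqxx ?xl ?orbT.
Qed.

(* With [s] interpreted as the full relation, [fact s x] says everywhere in the
   domain that the assertion [x] holds. *)
Definition fact (s : seq bool) (x : assertion) : concept :=
  match x with
  | AssertC A a => Ex (RName s) (And (Nominal a) (CName A))
  | AssertR r a b => Ex (RName s) (And (Nominal a) (Ex (RName r) (Nominal b)))
  end.

Definition pointed (s : seq bool) (e : database * seq bool) : concept :=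
  And (Nominal e.2) (conj_concept (map (fact s) e.1)).

(** Its negation is the disjunction of the examples in [P]. *)
Definition none_of (s : seq bool) (P : examples) : concept :=
  conj_concept (map (fun e => Neg (pointed s e)) P).

(** The nominal moves the claim to a fixed element, so truth at any [d] settles the assertion. *)
Lemma fact_holds (I : interp) (s : seq bool) (x : assertion) (d : dom I) :
  sem (fact s x) d -> holds I x.
Proof.
by case: x => [A a|r a b] /= [e _ [-> //]] [e' H E]; rewrite -E.
Qed.

(** From left to right, a model of the knowledge base is changed only at the fresh [s], which
    becomes the full relation and makes all facts true. From right to left, the concept forces the
    element to be [a] and the database to hold. *)
Lemma entails_pointed (O : ontology) (D : database) (s a : seq bool) (C : concept) :
  SRole s \notin sig_ontology O -> SRole s \notin sig_concept C ->
  (forall r b c, AssertR r b c \in D -> r <> s) ->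
  entails O (CI (pointed s (D, a)) C) <-> kb_entails O D C a.
Proof.
move=> sO sC sD; split=> H I.
  have [T [v ->]] := interp_ofP I => {I} -[mO mD].
  pose v' x : value T x :=
    match x return value T x with
    | SRole r => if r == s then fun _ _ => True else v (SRole r)
    | y => v y
    end.
  have vv' x : x != SRole s -> v x = v' x.
    by case: x => //= r; case: (r =P s) => // ->; rewrite eqxx.
  apply/(@sem_agree _ v v') => [x Cx|].
    by apply: vv'; apply: contraNneq sC => <-.
  apply: H => /=.
    apply: (proj1 (model_agree _)) mO => x Ox.
    by apply: vv'; apply: contraNneq sO => <-.
  split=> //; apply/(@sem_conj _ (interp_of v')) => -[A b|r b c] /[dup] xD /mD /= Hx.
    by exists (v (SInd b)); rewrite ?eqxx.
  exists (v (SInd b)); rewrite ?eqxx //; split=> //; exists (v (SInd c)) => //.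
  (* Role assertions of [D] avoid [s], so their edges survive the change. *)
  by have /eqP/negPf-> := sD _ _ _ xD.
move=> mO d /= [-> HD]; apply: H; split=> // x xD.
by move/sem_conj: HD => /(_ x xD); apply: fact_holds.
Qed.

(** Entailment distributes over a disjunction on the left. The disjunction is a negated conjunction
    here, so deriving [C] from it takes double negation elimination. *)
Lemma entails_some (O : ontology) (s : seq bool) (P : examples) (C : concept) :
  entails O (CI (Neg (none_of s P)) C) <->
  (forall D a, (D, a) \in P -> entails O (CI (pointed s (D, a)) C)).
Proof.
split=> H => [D a DP I mO d Hd|I mO d Hd].
  by apply: (H I mO d) => /sem_conj/(_ _ DP); apply.
apply: NNPP => nC; apply: Hd; apply/sem_conj => -[D a] DP Hd; apply: nC.
exact: H DP _ mO _ Hd.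
Qed.

(** Contraposition in each conjunct turns exclusion of an example into the form asked of a negative
    example. *)
Lemma entails_none (O : ontology) (s : seq bool) (P : examples) (C : concept) :
  entails O (CI C (none_of s P)) <->
  (forall D a, (D, a) \in P -> entails O (CI (pointed s (D, a)) (Neg C))).
Proof.
split=> H => [D a DP I mO d Hd Cd|I mO d Cd].
  by have /sem_conj/(_ _ DP) := H I mO d Cd.
by apply/sem_conj => -[D a] DP Hd; exact: H DP _ mO _ Hd Cd.
Qed.

(** * Renaming of symbols *)

Section Renaming.
Variable f : symbol -> seq bool.

Definition rename_symbol (s : symbol) : symbol :=
  match s with
  | SConcept _ => SConcept (f s)
  | SRole _ => SRole (f s)
  | SInd _ => SInd (f s)
  end.

Definition rename_role (r : role) : role :=
  match r with
  | RName s => RName (f (SRole s))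
  | RInv s => RInv (f (SRole s))
  end.

Fixpoint rename_concept (C : concept) : concept :=
  match C with
  | Top => Top
  | CName A => CName (f (SConcept A))
  | Nominal a => Nominal (f (SInd a))
  | Neg C => Neg (rename_concept C)
  | And C D => And (rename_concept C) (rename_concept D)
  | Ex r C => Ex (rename_role r) (rename_concept C)
  | ExU C => ExU (rename_concept C)
  end.

Definition rename_inclusion (i : inclusion) : inclusion :=
  match i with
  | CI C D => CI (rename_concept C) (rename_concept D)
  | RI r s => RI (rename_role r) (rename_role s)
  end.

Definition rename_ontology : ontology -> ontology := map rename_inclusion.

Lemma sig_rename_role r : sig_role (rename_role r) = map rename_symbol (sig_role r).
Proof. by case: r. Qed.

Lemma sig_rename_concept C :
  sig_concept (rename_concept C) = map rename_symbol (sig_concept C).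
Proof.
elim: C => //= [C -> D ->|r C ->]; by rewrite ?map_cat // sig_rename_role.
Qed.

Lemma sig_rename_ontology O :
  sig_ontology (rename_ontology O) = map rename_symbol (sig_ontology O).
Proof.
elim: O => [|i O IH] //=; rewrite /sig_ontology /= in IH *; rewrite IH map_cat.
by case: i => * /=; rewrite map_cat ?sig_rename_concept ?sig_rename_role.
Qed.

Lemma rename_role_in L r : role_in L (rename_role r) = role_in L r.
Proof. by case: r. Qed.

Lemma rename_concept_in L C : concept_in L (rename_concept C) = concept_in L C.
Proof. by elim: C => //= [C -> D -> //|r C ->|C -> //]; rewrite rename_role_in. Qed.

Lemma rename_ontology_in L O : ontology_in L (rename_ontology O) = ontology_in L O.
Proof.
rewrite /ontology_in all_map; apply: eq_all => -[C D|r s] /=.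
  by rewrite !rename_concept_in.
by rewrite !rename_role_in.
Qed.

Lemma rename_concept_id C :
  {in sig_concept C, forall s, f s = sname s} -> rename_concept C = C.
Proof.
elim: C => //= [A|a|C IH|C IHC D IHD|r C IH|C IH] H.
- by rewrite H ?mem_head.
- by rewrite H ?mem_head.
- by rewrite IH.
- rewrite IHC ?IHD // => s Hs; apply: H; rewrite mem_cat Hs ?orbT //.
- rewrite IH => [|s Hs]; last by apply: H; rewrite mem_cat Hs orbT.
  by case: r H => r H /=; rewrite H ?mem_head.
- by rewrite IH.
Qed.

Variables (T : Type) (v : forall s, value T s).

(** The pullback of [v] along [f]: renamed syntax under [v] means what the original syntax means
    under this valuation. *)
Definition precomp (s : symbol) : value T s :=
  match s return value T s with
  | SConcept A => v (SConcept (f (SConcept A)))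
  | SRole r => v (SRole (f (SRole r)))
  | SInd a => v (SInd (f (SInd a)))
  end.

Lemma role_rename r (d e : T) :
  @role_sem (interp_of v) (rename_role r) d e <-> @role_sem (interp_of precomp) r d e.
Proof. by case: r. Qed.

Lemma sem_rename C (d : T) :
  @sem (interp_of v) (rename_concept C) d <-> @sem (interp_of precomp) C d.
Proof.
elim: C d => //= [C IH|C IHC D IHD|r C IH|C IH] d.
- by rewrite IH.
- by rewrite IHC IHD.
- by split=> -[e /role_rename re /IH Ce]; exists e.
- by split=> -[e /IH Ce]; exists e.
Qed.

Lemma satisfies_rename i :
  satisfies (interp_of v) (rename_inclusion i) <-> satisfies (interp_of precomp) i.
Proof.
case: i => [C D|r s] /=; first by split=> H d /sem_rename /H /sem_rename.
by split=> H d e /role_rename /H /role_rename.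
Qed.

Lemma model_rename O :
  model (interp_of v) (rename_ontology O) <-> model (interp_of precomp) O.
Proof. by elim: O => [|i O IH] //=; rewrite satisfies_rename IH. Qed.

End Renaming.

(** * Two copies of an ontology that share a signature *)

Definition prefix_outside (S : signature) (w : seq bool) (s : symbol) : seq bool :=
  if s \in S then sname s else w ++ sname s.

(** A role is mentioned through [Ex], since the logic may not admit role inclusions. *)
Definition tautology (s : symbol) : inclusion :=
  CI (match s with
      | SConcept A => CName A
      | SRole r => Ex (RName r) Top
      | SInd a => Nominal a
      end) Top.

Lemma sig_tautologies (S : signature) : sig_ontology (map tautology S) = S.
Proof. by elim: S => [|[A|r|a] S IH] //=; rewrite /sig_ontology /= in IH *; rewrite IH. Qed.

Lemma model_tautologies (I : interp) (S : signature) : model I (map tautology S).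
Proof. by elim: S. Qed.

(* The tautologies make every symbol of [S] occur. *)
Definition copy (S : signature) (w : seq bool) (O : ontology) : ontology :=
  rename_ontology (prefix_outside S w) O ++ map tautology S.

(** Names outside [S] acquire the first bit of the prefix, and the tautologies add nothing beyond
    [S]. *)
Lemma copies_sig (S : signature) (b : bool) (w : seq bool) (O : ontology) (C : concept) :
  {in sig_of (copy S (b :: w) O)
    (rename_concept (prefix_outside S (b :: w)) C),
    forall s, s \in S \/ ohead (sname s) = Some b}.
Proof.
move=> s; rewrite /sig_of -/(sig_ontology _) /copy.
rewrite /sig_ontology map_cat flatten_cat -!/(sig_ontology _) sig_rename_ontology.
rewrite sig_tautologies sig_rename_concept.
have H l : s \in map (rename_symbol (prefix_outside S (b :: w))) l ->
    s \in S \/ ohead (sname s) = Some b.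
  case/mapP=> x _ ->; case xS: (x \in S); last first.
    by right; case: x xS => x xS /=; rewrite /prefix_outside xS.
  by left; case: x xS => x xS /=; rewrite /prefix_outside xS.
by rewrite !mem_cat => /orP[/orP[/H|]|/H] //; left.
Qed.

(** A shared symbol outside [S] would have to begin with both bits; conversely, the tautologies
    place all of [S] in both copies. *)
Lemma common_sig_copies (S : signature) (w w' : seq bool) (O : ontology) (C C' : concept) :
  S =i common_sig (copy S (true :: w) O) (rename_concept (prefix_outside S (true :: w)) C)
         (copy S (false :: w') O) (rename_concept (prefix_outside S (false :: w')) C').
Proof.
move=> s; rewrite mem_filter; apply/idP/andP => [sS|[s2 s1]].
  suff H u X : s \in sig_of (copy S u O) X by split; exact: H.
  rewrite /sig_of /copy map_cat flatten_cat -!/(sig_ontology _) sig_tautologies.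
  by rewrite !mem_cat sS orbT.
have [//|h1] := copies_sig s1; have [//|h2] := copies_sig s2.
by rewrite h1 in h2.
Qed.

Section Copies.
Variables (S : signature) (K : nat).
Hypothesis S_short : {in S, forall s, size (sname s) < K}.

(** A model of both copies pulls back along either renaming to a model of [O]. Conversely, a model
    of [O] interprets both copies at once when prefixes are stripped. *)
Lemma entails_copies (w w' u : seq bool) (O : ontology) (i : inclusion) :
  size w = K -> size w' = K -> u \in [:: w; w'] ->
  entails (copy S w O ++ copy S w' O) (rename_inclusion (prefix_outside S u) i) <->
  entails O i.
Proof.
move=> szw szw' ww'; split=> H I; have [T [v ->]] := interp_ofP I => {I} mO; last first.
  move/model_cat: mO => -[/model_cat[/model_rename mO1 _] /model_cat[/model_rename mO2 _]].
  by apply/satisfies_rename/H; move: ww'; rewrite !inE => /orP[] /eqP->.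
(* Prefixes of equal length let one map undo both renamings. *)
pose g s := if s \in S then sname s else drop K (sname s).
have fK u' s : size u' = K ->
    precomp (prefix_outside S u') (precomp g v) s = v s.
  move=> szu'; have key (c : seq bool -> symbol) x :
      (forall y, sname (c y) = y) -> g (c (prefix_outside S u' (c x))) = x.
    move=> cK; rewrite /g /prefix_outside; case cxS: (c x \in S).
      by rewrite !cK cxS.
    (* A prefixed name has at least [K] bits and those in [S] have fewer, so [g] strips it. *)
    rewrite !cK drop_size_cat // ifF //; apply/negbTE/negP => /S_short.
    by rewrite cK size_cat szu' ltnNge leq_addr.
  by case: s => x /=; rewrite key.
have mO' u' : size u' = K ->
    model (interp_of (precomp g v)) (rename_ontology (prefix_outside S u') O).
  by move=> szu'; apply/model_rename; apply: (proj1 (model_agree _)) mO => s _; rewrite fK.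
have szu : size u = K by move: ww'; rewrite !inE => /orP[] /eqP->.
have {H}: satisfies (interp_of (precomp g v)) (rename_inclusion (prefix_outside S u) i).
  apply: H; apply/model_cat; split; apply/model_cat; split; try exact: model_tautologies;
  exact: mO'.
by move/satisfies_rename; apply: (proj1 (satisfies_agree _)) => s _; rewrite fK.
Qed.

End Copies.

(** * Inclusions tested by a single assertion *)

Section FreshExample.
Variables (O : ontology) (C1 C2 C : concept) (A1 A2 a : seq bool).
Let S := sig_ontology O ++ sig_concept C1 ++ sig_concept C2 ++ sig_concept C.
Hypotheses (A1S : SConcept A1 \notin S) (A2S : SConcept A2 \notin S).
Hypotheses (aS : SInd a \notin S) (A12 : A1 != A2).

Definition with_tests : ontology :=
  [:: CI (CName A1) C1, CI (CName A2) (Neg C2) & O].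

Section Expansion.
Variables (T : Type) (v : forall s, value T s) (d : T).

(** [A1] and [A2] get the largest extensions that the tests permit, and [a] names the chosen [d]. *)
Let v' s : value T s :=
  match s return value T s with
  | SConcept A => if A == A1 then @sem (interp_of v) C1
                  else if A == A2 then fun e => ~ @sem (interp_of v) C2 e
                  else v (SConcept A)
  | SInd b => if b == a then d else v (SInd b)
  | s => v s
  end.

Let vv' s : s \in S -> v s = v' s.
Proof.
case: s => [A|//|b] Ss /=.
  have /negPf-> : A != A1 by apply: contraNneq A1S => <-.
  by have /negPf-> : A != A2 by apply: contraNneq A2S => <-.
by have /negPf-> : b != a by apply: contraNneq aS => <-.
Qed.

(** As [d] is arbitrary, a statement about [a] tests an inclusion at every element; freshness
    preserves the meaning of [C]. *)
Lemma expansion : model (interp_of v) O ->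
  exists v' : forall s, value T s,
  [/\ model (interp_of v') with_tests,
      forall e, v' (SConcept A1) e <-> @sem (interp_of v) C1 e,
      forall e, v' (SConcept A2) e <-> ~ @sem (interp_of v) C2 e,
      v' (SInd a) = d &
      forall e, @sem (interp_of v') C e <-> @sem (interp_of v) C e].
Proof.
have semE X : {subset sig_concept X <= S} -> forall e,
    @sem (interp_of v) X e <-> @sem (interp_of v') X e.
  by move=> XS e; apply: sem_agree => s /XS /vv'.
move=> mO; exists v'; split.
- rewrite /= eqxx (eq_sym A2) (negPf A12) eqxx; split; last split.
  + by move=> e /=; rewrite -semE // => s Hs; rewrite !mem_cat Hs !orbT.
  + by move=> e /=; rewrite -semE // => s Hs; rewrite !mem_cat Hs !orbT.
  + by apply: (proj1 (model_agree _)) mO => s Hs; apply: vv'; rewrite mem_cat Hs.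
- by rewrite /= eqxx.
- by rewrite /= eqxx (eq_sym A2) (negPf A12).
- by rewrite /= eqxx.
- by move=> e; rewrite -semE // => s Hs; rewrite !mem_cat Hs !orbT.
Qed.

End Expansion.

(** Any instance of [C1] can be named [a] in an expansion where [A1] coincides with [C1];
    conversely, the test for [A1] puts [a] into [C1]. *)
Lemma entails_positive :
  kb_entails with_tests [:: AssertC A1 a] C a <-> entails O (CI C1 C).
Proof.
split=> H I.
  have [T [v ->]] := interp_ofP I => {I} mO d Cd.
  have [v' [mO' v1 _ va vC]] := expansion d mO.
  apply/vC; rewrite -va; apply: (H (interp_of v')); split=> // x.
  by rewrite inE => /eqP-> /=; rewrite va; apply/v1.
by move=> [[H1 [_ mO]] HD]; apply: H mO _ _; apply: H1; apply: HD (mem_head _ _).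
Qed.

(** An instance of [C] outside [C2] could be named [a] in an expansion and would refute the left
    side, whence [C2] by double negation elimination. Conversely, [A2] keeps [a] out of [C2], hence
    out of [C]. *)
Lemma entails_negative :
  kb_entails with_tests [:: AssertC A2 a] (Neg C) a <-> entails O (CI C C2).
Proof.
split=> H I.
  have [T [v ->]] := interp_ofP I => {I} mO d Cd.
  have [v' [mO' _ v2 va vC]] := expansion d mO.
  apply: NNPP => nC2; apply: (H (interp_of v')) => [|/=]; last by rewrite va; apply/vC.
  by split=> // x; rewrite inE => /eqP-> /=; rewrite va; apply/v2.
move=> [[_ [H2 mO]] HD] /= Ca; apply: (H2 _ (HD _ (mem_head _ _))).
exact: H mO _ Ca.
Qed.

End FreshExample.

(** * The two reductions *)

(** The source of freshness: a name as long as the size of an encoding cannot occur in it. *)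
Lemma size_enc_name (x : seq bool) : size x < tree_size (enc_name x).
Proof. by elim: x => //= b x IH; have := tree_size_gt0 (enc_bool b); lia. Qed.

Lemma size_sig_role r s : s \in sig_role r -> size (sname s) < tree_size (enc_role r).
Proof.
by case: r => x /=; rewrite inE => /eqP->; have := size_enc_name x; rewrite /=; lia.
Qed.

Lemma size_sig_concept C s :
  s \in sig_concept C -> size (sname s) < tree_size (enc_concept C).
Proof.
elim: C => //= [A|a|C IH|C IHC D IHD|r C IH|C IH].
- by rewrite inE => /eqP->; have := size_enc_name A; rewrite /=; lia.
- by rewrite inE => /eqP->; have := size_enc_name a; rewrite /=; lia.
- by move/IH; lia.
- by rewrite mem_cat => /orP[/IHC|/IHD]; lia.
- by rewrite mem_cat => /orP[/size_sig_role|/IH]; lia.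
- by move/IH; lia.
Qed.

Lemma size_sig_ontology O s :
  s \in sig_ontology O -> size (sname s) < tree_size (enc_ontology O).
Proof.
elim: O => //= i O IH; rewrite /sig_ontology /= -/(sig_ontology O) mem_cat.
case/orP=> [|/IH]; last by lia.
case: i => [C D|r t] /=; rewrite mem_cat.
  by case/orP=> /size_sig_concept; lia.
by case/orP=> /size_sig_role; lia.
Qed.

Lemma size_enc_mem (X : eqType) (enc : X -> tree) (l : seq X) (x : X) :
  x \in l -> tree_size (enc x) < tree_size (enc_seq enc l).
Proof.
by elim: l => //= y l IH; rewrite inE => /predU1P[->|/IH]; lia.
Qed.

Lemma size_sig_signature (S : signature) s :
  s \in S -> size (sname s) < tree_size (enc_signature S).
Proof.
move/(size_enc_mem enc_symbol); apply: leq_trans; apply: leqW.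
by case: s => x /=; have := size_enc_name x; lia.
Qed.

Lemma size_assertion_role (r b c a : seq bool) (D : database) (P : examples) :
  (D, a) \in P -> AssertR r b c \in D -> size r < tree_size (enc_examples P).
Proof.
move=> /(size_enc_mem (enc_pair (enc_seq enc_assertion) enc_name)) /=.
move=> HP /(size_enc_mem enc_assertion) /=; have := size_enc_name r.
rewrite -/enc_examples in HP *; lia.
Qed.

(** * Correctness of the tree functions on encodings *)

Lemma enc_seq_inj (X : Type) (enc : X -> tree) : injective enc -> injective (enc_seq enc).
Proof. by move=> inj; elim=> [|x s IH] [|y t] //= [/inj-> /IH->]. Qed.

Lemma enc_name_inj : injective enc_name.
Proof. by apply: enc_seq_inj => -[] []. Qed.

Lemma enc_symbol_inj : injective enc_symbol.
Proof. by move=> [x|x|x] [y|y|y] //= [/enc_name_inj->]. Qed.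

(** Injectivity lets equality of trees stand for equality of symbols. *)
Lemma tmem_enc_signature S s : tmem (enc_symbol s) (enc_signature S) = (s \in S).
Proof.
elim: S => //= t S ->; rewrite inE; congr (_ || _).
by apply/teqP/eqP => [/enc_symbol_inj|->].
Qed.

Lemma enc_seq_cat (X : Type) (enc : X -> tree) (s t : seq X) :
  enc_seq enc (s ++ t) = tapp (enc_seq enc s) (enc_seq enc t).
Proof. by elim: s => //= x s ->. Qed.

(** The bit [false] is encoded by [Leaf], so words of zeros are unary numerals. *)
Lemma enc_name_nseq n : enc_name (nseq n false) = numeral n.
Proof. by elim: n => //= n ->. Qed.

Section RenameEncoding.
Variables (S : signature) (w : seq bool).
Local Notation f := (prefix_outside S w).
Local Notation tren := (trename (enc_signature S) (enc_name w)).

Lemma trename_enc_name k s : enc_symbol s = Node (numeral k) (enc_name (sname s)) ->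
  tren (enc_name (sname s)) (st_name k) = enc_name (f s).
Proof.
(* The fixpoint unfolds only on a constructor, so the empty name, encoded by [Leaf], is split from
   the others. *)
move=> Es; transitivity (trename_name (enc_signature S) (enc_name w) (numeral k)
  (enc_name (sname s))); first by case: (enc_name (sname s)).
rewrite /trename_name -Es tmem_enc_signature /prefix_outside.
by case: (s \in S) => //; rewrite -enc_seq_cat.
Qed.

Lemma trename_enc_role r : tren (enc_role r) st_role = enc_role (rename_role f r).
Proof.
by case: r => s /=; rewrite -(@trename_enc_name 1 (SRole s) erefl).
Qed.

Lemma trename_enc_concept C :
  tren (enc_concept C) st_concept = enc_concept (rename_concept f C).
Proof.
elim: C => [|A|a|C IH|C IHC D IHD|r C IH|C IH] //=.
- by rewrite -(@trename_enc_name 0 (SConcept A) erefl).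
- by rewrite -(@trename_enc_name 2 (SInd a) erefl).
- by rewrite -IH.
- by rewrite -IHC -IHD.
- by rewrite -IH -trename_enc_role.
- by rewrite -IH.
Qed.

Lemma trename_enc_ontology O :
  tren (enc_ontology O) st_ontology = enc_ontology (rename_ontology f O).
Proof.
elim: O => // i O IH.
rewrite /enc_ontology /= -/enc_ontology -IH; case: i => [C D|r s] /=.
  by rewrite -!trename_enc_concept.
by rewrite -!trename_enc_role.
Qed.

End RenameEncoding.

(** The argument pairs an environment with an encoded symbol. The branches, from top to bottom,
    treat the tags 2, 1 and 0: individuals, roles, concept names. *)
Definition ttautology (z : tree) : tree :=
  Node Leaf (Node
    (if tleft (tright z) is Node _ _ then
       if tright (tleft (tright z)) is Node _ _
       then Node (numeral 2) (tright (tright z))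
       else Node (numeral 5)
              (Node (Node (numeral 0) (tright (tright z))) (Node (numeral 0) Leaf))
     else Node (numeral 1) (tright (tright z)))
    (Node (numeral 0) Leaf)).

(** The environment [tleft z] is the encoded name of the fresh role; a nonzero tag marks a role
    assertion. *)
Definition tfact (z : tree) : tree :=
  Node (numeral 5) (Node (Node (numeral 0) (tleft z))
    (if tleft (tright z) is Node _ _ then
       Node (numeral 4) (Node
         (Node (numeral 2) (tleft (tright (tright (tright z)))))
         (Node (numeral 5) (Node (Node (numeral 0) (tleft (tright (tright z))))
            (Node (numeral 2) (tright (tright (tright (tright z))))))))
     else
       Node (numeral 4) (Node
         (Node (numeral 2) (tright (tright (tright z))))
         (Node (numeral 1) (tleft (tright (tright z))))))).

Definition tnot_pointed (z : tree) : tree :=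
  Node (numeral 3) (Node (numeral 4) (Node
    (Node (numeral 2) (tright (tright z)))
    (tconj (tmap tfact (tleft z) (tleft (tright z)))))).

Lemma ptime_ttautology : ptime ttautology. Proof. by rewrite /ttautology; ptime. Qed.
Lemma ptime_tfact : ptime tfact. Proof. by rewrite /tfact; ptime. Qed.
Lemma ptime_tnot_pointed : ptime tnot_pointed.
Proof.
rewrite /tnot_pointed; ptime.
by apply: ptime_tconj; apply: ptime_tmap ptime_tfact _ _; ptime.
Qed.

Lemma tmap_enc_seq (X Y : Type) (encX : X -> tree) (encY : Y -> tree)
    (G : tree -> tree) (g : X -> Y) e l :
  (forall x, G (Node e (encX x)) = encY (g x)) ->
  tmap G e (enc_seq encX l) = enc_seq encY (map g l).
Proof. by move=> H; elim: l => //= x l ->; rewrite H. Qed.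

Lemma tconj_enc_seq l : tconj (enc_seq enc_concept l) = enc_concept (conj_concept l).
Proof. by elim: l => //= C l ->. Qed.

Lemma enc_tautologies S : tmap ttautology Leaf (enc_signature S) =
  enc_ontology (map tautology S).
Proof. by apply: tmap_enc_seq => -[]. Qed.

Lemma enc_none_of s P : tconj (tmap tnot_pointed (enc_name s) (enc_examples P)) =
  enc_concept (none_of s P).
Proof.
rewrite (@tmap_enc_seq _ _ _ enc_concept _ (fun e => Neg (pointed s e))).
  exact: tconj_enc_seq.
case=> D a; rewrite /tnot_pointed /=.
rewrite (@tmap_enc_seq _ _ _ enc_concept _ (fact s)) ?tconj_enc_seq //.
by case.
Qed.

Definition tcopy (S w O : tree) : tree :=
  tapp (trename S w O st_ontology) (tmap ttautology Leaf S).

Lemma enc_copy S w O :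
  tcopy (enc_signature S) (enc_name w) (enc_ontology O) = enc_ontology (copy S w O).
Proof.
by rewrite /tcopy enc_tautologies trename_enc_ontology /enc_ontology -enc_seq_cat.
Qed.

Lemma ptime_tcopy F1 F2 F3 : ptime F1 -> ptime F2 -> ptime F3 ->
  ptime (fun x => tcopy (F1 x) (F2 x) (F3 x)).
Proof.
move=> p1 p2 p3; apply: ptime_tapp; first by apply: ptime_trename; ptime.
by apply: ptime_tmap ptime_ttautology _ _; ptime.
Qed.

Definition tnone_of (s P : tree) : tree := tconj (tmap tnot_pointed s P).

Lemma ptime_tnone_of F1 F2 : ptime F1 -> ptime F2 ->
  ptime (fun x => tnone_of (F1 x) (F2 x)).
Proof. by move=> p1 p2; apply/ptime_tconj/ptime_tmap => //; exact: ptime_tnot_pointed. Qed.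

(** [C1] is the disjunction of the positive examples in the first copy, [C2] excludes the negative
    ones in the second. A concept over [Sg] is fixed by both renamings, so [entails_copies] returns
    each half of the interpolation condition to [Ont]. *)
Lemma interpolation_from_separation (L : dl) : nominals L ->
  polytime_constructible enc_OPNS enc_OOCC
    (fun '(Ont, P, N, Sg) =>
       [/\ ontology_in L Ont, wf_examples P, wf_examples N &
           forall D a, (D, a) \in P ++ N -> SInd a \notin Sg])
    (fun '(Ont, P, N, Sg) '(O1, O2, C1, C2) =>
       [/\ [/\ ontology_in L O1, ontology_in L O2,
               concept_in L C1 & concept_in L C2],
           Sg =i common_sig O1 C1 O2 C2 &
           forall C, concept_in L C ->
             (separator L Sg Ont P N C <->
              interpolant L Sg (O1 ++ O2) C1 C2 C)]).
Proof.
move=> hO.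
pose F x :=
  let s := numeral (tree_size x) in
  let w b := Node (enc_bool b) s in
  let S := tright x in
  let O := tleft (tleft (tleft x)) in
  let P := tright (tleft (tleft x)) in
  let N := tright (tleft x) in
  Node (Node (Node (tcopy S (w true) O) (tcopy S (w false) O))
    (Node (numeral 3) (trename S (w true) (tnone_of s P) st_concept)))
    (trename S (w false) (tnone_of s N) st_concept).
(* The word [s] serves twice: as the fresh role name and, behind one distinguishing bit, as the
   prefix of a copy. *)
pose f x := let: (Ont, P, N, Sg) := x in
  let s := nseq (tree_size (enc_OPNS x)) false in
  (copy Sg (true :: s) Ont, copy Sg (false :: s) Ont,
   Neg (rename_concept (prefix_outside Sg (true :: s)) (none_of s P)),
   rename_concept (prefix_outside Sg (false :: s)) (none_of s N)).
have pF : ptime F.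
  have ps : ptime (fun x => numeral (tree_size x)) by exact/ptime_numeral_size/ptime_arg.
  have pw b : ptime (fun x => Node (enc_bool b) (numeral (tree_size x))) by ptime.
  apply: ptime_node; first apply: ptime_node; first apply: ptime_node.
  - by apply: ptime_tcopy => //; ptime.
  - by apply: ptime_tcopy => //; ptime.
  - apply: ptime_node; first exact: ptime_const.
    by apply: ptime_trename => //; ptime; apply: ptime_tnone_of => //; ptime.
  - by apply: ptime_trename => //; ptime; apply: ptime_tnone_of => //; ptime.
apply: (ptime_constructible pF (f := f)) => [[[[Ont P] N] Sg]|[[[Ont P] N] Sg]].
  rewrite /F /f; set K := tree_size _; cbv zeta.
  have wE b : Node (enc_bool b) (numeral K) = enc_name (b :: nseq K false).
    by rewrite /= enc_name_nseq.
  rewrite !wE -(enc_name_nseq K) /tnone_of.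
  cbn [enc_OPNS enc_OPN enc_pair tleft tright fst snd].
  by rewrite !enc_none_of !enc_copy !trename_enc_concept.
case=> [OL _ _ _]; rewrite /f; set K := tree_size _; set s := nseq K false.
have szs : size s = K by rewrite size_nseq.
clearbody s.
(* The 3 counts the pairing nodes; [K] exceeds the size of every component. *)
have KE : K = (tree_size (enc_ontology Ont) + tree_size (enc_examples P) +
  tree_size (enc_examples N) + tree_size (enc_signature Sg)).+3.
  by rewrite /K /=; lia.
clearbody K.
have Sgs : {in Sg, forall y, size (sname y) < K}.
  by move=> y /size_sig_signature; lia.
(* The prefixes put one bit in front of [s], hence have length [K.+1]. *)
have Sgs' : {in Sg, forall y, size (sname y) < K.+1}.
  by move=> y /Sgs; lia.
have tautL : ontology_in L (map tautology Sg).
  by rewrite /ontology_in all_map; apply/allP => -[x|x|x] _ /=; rewrite ?hO.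
have conjL X (g : X -> concept) l : (forall x, concept_in L (g x)) ->
    concept_in L (conj_concept (map g l)).
  by move=> gL; elim: l => //= x l ->; rewrite gL.
have noneL Q : concept_in L (none_of s Q).
  apply: (conjL) => -[D a] /=; rewrite hO; apply: conjL => -[A b|r b c] /=; rewrite hO //.
split; first split.
- by rewrite /ontology_in all_cat -!/(ontology_in _ _) rename_ontology_in OL.
- by rewrite /ontology_in all_cat -!/(ontology_in _ _) rename_ontology_in OL.
- by rewrite /= rename_concept_in.
- by rewrite rename_concept_in.
- exact: (common_sig_copies _ s s Ont (Neg (none_of s P)) (none_of s N)).
move=> C _.
have fresh Q D a : (D, a) \in Q -> Q = P \/ Q = N ->
    forall r b c, AssertR r b c \in D -> r <> s.
  move=> DQ QPN r b c /(size_assertion_role DQ) + E.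
  by rewrite E szs; case: QPN => ->; lia.
have sO : SRole s \notin sig_ontology Ont.
  by apply/negP => /size_sig_ontology /=; rewrite szs; lia.
suff red : {subset sig_concept C <= Sg} ->
   ((forall D a, (D, a) \in P -> kb_entails Ont D C a) <->
    entails (copy Sg (true :: s) Ont ++ copy Sg (false :: s) Ont)
     (CI (Neg (rename_concept (prefix_outside Sg (true :: s)) (none_of s P))) C)) /\
   ((forall D a, (D, a) \in N -> kb_entails Ont D (Neg C) a) <->
    entails (copy Sg (true :: s) Ont ++ copy Sg (false :: s) Ont)
     (CI C (rename_concept (prefix_outside Sg (false :: s)) (none_of s N)))).
  split=> -[[CL CS] H1 H2]; have [E1 E2] := red CS; split=> //.
  - exact/E1.
  - exact/E2.
  - exact/E1.
  - exact/E2.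
move=> CS.
(* [C] is not part of the input; [s] avoids it because its symbols lie in [Sg], where all names are
   shorter. *)
have sC : SRole s \notin sig_concept C.
  by apply/negP => /CS /Sgs /=; rewrite szs ltnn.
have CE w : rename_concept (prefix_outside Sg w) C = C.
  by apply: rename_concept_id => y /CS ySg; rewrite /prefix_outside ySg.
have H b i := @entails_copies Sg K.+1 Sgs' (true :: s) (false :: s) (b :: s) Ont i.
rewrite /= !szs in H; split.
  have /= := H true (CI (Neg (none_of s P)) C) erefl erefl.
  rewrite CE => -> //; rewrite ?inE ?eqxx // entails_some.
  split=> HH D a DP; have := HH D a DP; rewrite entails_pointed //;
    exact: fresh DP (or_introl erefl).
have /= := H false (CI C (none_of s N)) erefl erefl.
rewrite CE => -> //; rewrite ?inE ?eqxx ?orbT // entails_none.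
split=> HH D a DP; have := HH D a DP; rewrite entails_pointed //;
  exact: fresh DP (or_intror erefl).
Qed.

(** Both examples are single assertions about one fresh individual; the ontology ties their concept
    names to [C1] and to the complement of [C2]. *)
Lemma separation_from_interpolation (L : dl) :
  polytime_constructible enc_OOCC enc_OPN
    (fun '(O1, O2, C1, C2) =>
       [/\ ontology_in L O1, ontology_in L O2,
           concept_in L C1 & concept_in L C2])
    (fun '(O1, O2, C1, C2) '(Ont, P, N) =>
       [/\ ontology_in L Ont, wf_examples P, wf_examples N &
           forall C, concept_in L C ->
             let Sg := common_sig O1 C1 O2 C2 in
             (separator L Sg Ont P N C <->
              interpolant L Sg (O1 ++ O2) C1 C2 C)]).
Proof.
pose F x :=
  let s := numeral (tree_size x) in
  let O1 := tleft (tleft (tleft x)) in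
  let O2 := tright (tleft (tleft x)) in
  let C1 := tright (tleft x) in
  let C2 := tright x in
  let example A := Node (Node (Node (Node (numeral 0) (Node A s)) Leaf) s) Leaf in
  Node (Node
    (Node (Node (numeral 0) (Node (Node (numeral 1) s) C1))
      (Node (Node (numeral 0) (Node (Node (numeral 1) (Node Leaf s)) (Node (numeral 3) C2)))
        (tapp O1 O2)))
    (example s)) (example (Node Leaf s)).
(* [s] names both the individual and the first test concept, which differ in kind; [false :: s],
   encoded by [Node Leaf s], names the second. *)
pose f x := let: (O1, O2, C1, C2) := x in
  let s := nseq (tree_size (enc_OOCC x)) false in
  (with_tests (O1 ++ O2) C1 C2 s (false :: s),
   [:: ([:: AssertC s s], s)], [:: ([:: AssertC (false :: s) s], s)]).
have pF : ptime F.
  have ps : ptime (fun x => numeral (tree_size x)) by exact/ptime_numeral_size/ptime_arg.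
  by rewrite /F; ptime; apply: ptime_tapp; ptime.
apply: (ptime_constructible pF (f := f)) => [[[[O1 O2] C1] C2]|[[[O1 O2] C1] C2]].
  rewrite /F /f; set K := tree_size _; cbv zeta.
  rewrite -(enc_name_nseq K); cbn [enc_OOCC enc_pair tleft tright fst snd].
  by rewrite /enc_ontology -enc_seq_cat.
case=> [O1L O2L C1L C2L]; rewrite /f; set K := tree_size _; set s := nseq K false.
have szs : size s = K by rewrite size_nseq.
clearbody s.
have KE : K = (tree_size (enc_ontology O1) + tree_size (enc_ontology O2) +
  tree_size (enc_concept C1) + tree_size (enc_concept C2)).+3.
  by rewrite /K /=; lia.
clearbody K.
split.
- by rewrite /= C1L C2L /ontology_in all_cat -!/(ontology_in _ _) O1L.
- by rewrite /= mem_head.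
- by rewrite /= mem_head.
move=> C _ /=.
suff red : {subset sig_concept C <= common_sig O1 C1 O2 C2} ->
    (kb_entails (with_tests (O1 ++ O2) C1 C2 s (false :: s)) [:: AssertC s s] C s <->
     entails (O1 ++ O2) (CI C1 C)) /\
    (kb_entails (with_tests (O1 ++ O2) C1 C2 s (false :: s))
       [:: AssertC (false :: s) s] (Neg C) s <->
     entails (O1 ++ O2) (CI C C2)).
  split=> -[[CL CS] H1 H2]; have [E1 E2] := red CS; split=> //.
  - exact/E1/H1/mem_head.
  - exact/E2/H2/mem_head.
  - by move=> D a; rewrite inE => /eqP[-> ->]; apply/E1.
  - by move=> D a; rewrite inE => /eqP[-> ->]; apply/E2.
move=> CS.
have fresh y : K <= size (sname y) ->
    y \notin sig_ontology (O1 ++ O2) ++ sig_concept C1 ++ sig_concept C2 ++ sig_concept C.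
  move=> Ky; have bO O : tree_size (enc_ontology O) <= K -> y \notin sig_ontology O.
    by move=> OK; apply/negP => /size_sig_ontology; lia.
  have bC D : tree_size (enc_concept D) <= K -> y \notin sig_concept D.
    by move=> DK; apply/negP => /size_sig_concept; lia.
  have nO1 : y \notin sig_ontology O1 by apply: (bO); lia.
  have nO2 : y \notin sig_ontology O2 by apply: (bO); lia.
  have nC1 : y \notin sig_concept C1 by apply: (bC); lia.
  have nC2 : y \notin sig_concept C2 by apply: (bC); lia.
  (* The size of [C] is unbounded, but its symbols already occur in [O1] or [C1]. *)
  have nC : y \notin sig_concept C.
    apply/negP => /CS; rewrite mem_filter => /andP[_].
    by rewrite /sig_of mem_cat -/(sig_ontology _) (negPf nO1) (negPf nC1).
  rewrite /sig_ontology map_cat flatten_cat -!/(sig_ontology _) !mem_cat !negb_or.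
  by rewrite nO1 nO2 nC1 nC2 nC.
have neq : s != false :: s by apply/eqP => /(congr1 size) /=; lia.
split.
  by apply: entails_positive neq; apply: fresh; rewrite /= szs.
by apply: entails_negative neq; apply: fresh; rewrite /= szs.
Qed.

Theorem theorem6 (L : dl) (hL : DLnr L) (hO : nominals L) :
  polytime_constructible enc_OPNS enc_OOCC
    (fun '(Ont, P, N, Sg) =>
       [/\ ontology_in L Ont, wf_examples P, wf_examples N &
           forall D a, (D, a) \in P ++ N -> SInd a \notin Sg])
    (fun '(Ont, P, N, Sg) '(O1, O2, C1, C2) =>
       [/\ [/\ ontology_in L O1, ontology_in L O2,
               concept_in L C1 & concept_in L C2],
           Sg =i common_sig O1 C1 O2 C2 &
           forall C, concept_in L C ->
             (separator L Sg Ont P N C <->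
              interpolant L Sg (O1 ++ O2) C1 C2 C)])
  /\
  polytime_constructible enc_OOCC enc_OPN
    (fun '(O1, O2, C1, C2) =>
       [/\ ontology_in L O1, ontology_in L O2,
           concept_in L C1 & concept_in L C2])
    (fun '(O1, O2, C1, C2) '(Ont, P, N) =>
       [/\ ontology_in L Ont, wf_examples P, wf_examples N &
           forall C, concept_in L C ->
             let Sg := common_sig O1 C1 O2 C2 in
             (separator L Sg Ont P N C <->
              interpolant L Sg (O1 ++ O2) C1 C2 C)]).
Proof.
split; first exact: interpolation_from_separation.
exact: separation_from_interpolation.
Qed.
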